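(* Consider the data setting, the set $\Sigma_c$, and the matrices $P_c$, $\tilde P_c$ defined in the context. Suppose that $P_c$ is invertible and has exactly $m_d$ positive eigenvalues (so that $\tilde P_c$ is well defined). Let $K\in\mathbb{R}^{m\times n}$ and $h>0$. Suppose there exist scalars $\lambda_1>0$, $\lambda_2>0$, symmetric matrices $P_1\succ 0$, $R\succ 0$ in $\mathbb{R}^{n\times n}$, and matrices $P_2,P_3\in\mathbb{R}^{n\times n}$ such that, with $$P=\begin{bmatrix} P_1 & 0 \\ P_2 & P_3 \end{bmatrix},\qquad P_R=\mathrm{diag}(P,R),\qquad P_{R2}=\begin{bmatrix} P_1 & 0 \\ P_2 & P_3 \\ 0 & R \end{bmatrix},$$ the following two matrix inequalities hold: $$F_1^\top\begin{bmatrix} 0 & P_{R2}^\top & 0 \\ P_{R2} & 0 & 0 \\ 0 & 0 & \lambda_1\tilde P_c \end{bmatrix}F_1\prec 0,\qquad F_1=\begin{bmatrix} I_{2n} & 0 \\ \begin{bmatrix} 0 & I \\ 0 & -I \\ 0 & \tfrac12 hI \end{bmatrix} & \begin{bmatrix} 0 \\ I \\ 0 \end{bmatrix} \\ 0 & I_n \\ \begin{bmatrix} I & 0 \\ K & 0 \end{bmatrix} & \begin{bmatrix} 0 \\ 0 \end{bmatrix} \end{bmatrix},$$ $$F_2^\top\begin{bmatrix} 0 & P_R^\top & 0 \\ P_R & 0 & 0 \\ 0 & 0 & \lambda_2\tilde P_c \end{bmatrix}F_2\prec 0,\qquad F_2=\begin{bmatrix} I_{3n} & 0 \\ \begin{bmatrix}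 0 & I & 0 \\ 0 & -I & 0 \\ 0 & 0 & -\tfrac12 hI \end{bmatrix} & \begin{bmatrix} 0 \\ I \\ 0 \end{bmatrix} \\ 0 & I_n \\ \begin{bmatrix} I & 0 & 0 \\ K & 0 & -hK \end{bmatrix} & \begin{bmatrix} 0 \\ 0 \end{bmatrix} \end{bmatrix}.$$ Then, for every $(A,B)\in\Sigma_c$ and every sampling sequence $\{t_k\}_{k=0}^\infty$ with $t_0=0$, $t_{k+1}-t_k\in(0,h]$ for all $k\in\mathbb{N}_0$, and $\lim_{k\to\infty}t_k=\infty$, the system $\dot x(t)=Ax(t)+Bu(t)$ with sampled-data controller $u(t)=Kx(t_k)$ for $t\in[t_k,t_{k+1})$, $k\in\mathbb{N}_0$, is exponentially stable.
   Context: Data setting. Let $n,m,m_d,N$ be positive integers. The columns of $\dot X=[\dot x(\tau_1)\ \cdots\ \dot x(\tau_N)]\in\mathbb{R}^{n\times N}$, $X=[x(\tau_1)\ \cdots\ x(\tau_N)]\in\mathbb{R}^{n\times N}$, $U=[u(\tau_1)\ \cdots\ u(\tau_N)]\in\mathbb{R}^{m\times N}$ are measurements, at not necessarily equidistant times $\tau_1,\dots,\tau_N$, of a system $\dot x(t)=A_{\mathrm{tr}}x(t)+B_{\mathrm{tr}}u(t)+B_dd(t)$ with unknown $A_{\mathrm{tr}}\in\mathbb{R}^{n\times n}$, $B_{\mathrm{tr}}\in\mathbb{R}^{n\times m}$ and unknown disturbance; that is, $\dot X=A_{\mathrm{tr}}X+B_{\mathrm{tr}}U+B_d\hat D$ for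 some (unknown) $\hat D\in\mathcal{D}$. The matrix $B_d\in\mathbb{R}^{n\times m_d}$ is known and has full column rank. The noise set is $$\mathcal{D}=\left\{D\in\mathbb{R}^{m_d\times N}\ \middle|\ \begin{bmatrix} D^\top \\ I \end{bmatrix}^\top\begin{bmatrix} Q_d & S_d \\ S_d^\top & R_d \end{bmatrix}\begin{bmatrix} D^\top \\ I \end{bmatrix}\succeq 0\right\},$$ with given symmetric $Q_d\in\mathbb{R}^{N\times N}$, symmetric $R_d\in\mathbb{R}^{m_d\times m_d}$, $S_d\in\mathbb{R}^{N\times m_d}$, and $Q_d\prec 0$. The set of systems consistent with the data is $\Sigma_c=\{(A,B)\in\mathbb{R}^{n\times n}\times\mathbb{R}^{n\times m}\mid \exists D\in\mathcal{D}:\ \dot X=AX+BU+B_dD\}$. With $Z=\begin{bmatrix} X \\ U \end{bmatrix}$, define $$P_c=\begin{bmatrix} Q_c & S_c \\ S_c^\top & R_c \end{bmatrix}=\begin{bmatrix} -Z & 0 \\ \dot X & B_d \end{bmatrix}\begin{bmatrix} Q_d & S_d \\ S_d^\top & R_d \end{bmatrix}\begin{bmatrix} -Z & 0 \\ \dot X & B_d \end{bmatrix}^\top,$$ with $Q_c\in\mathbb{R}^{(n+m)\times(n+m)}$, $R_c\in\mathbb{R}^{n\times n}$. When $P_c$ is invertible, define $$\begin{bmatrix} \tilde Q_c & \tilde S_c \\ \tilde S_c^\top & \tilde R_c \end{bmatrix}=P_c^{-1},\qquad \tilde P_c=\begin{bmatrix} -\tilde R_c & \tilde S_c^\top \\ \tilde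 S_c & -\tilde Q_c \end{bmatrix},$$ where the first partition has the same block sizes as that of $P_c$ (so the upper left block $-\tilde R_c$ of $\tilde P_c$ is $n\times n$). For symmetric matrices, $\succ,\succeq,\prec,\preceq$ denote positive definite, positive semidefinite, negative definite, negative semidefinite. $I$ and $0$ are identity and zero matrices of appropriate size ($n\times n$ for the unsubscripted $I$ inside $F_1,F_2$). $\mathbb{N}_0$ is the set of nonnegative integers. Exponential stability of the closed loop is meant in the usual sense: there are constants $c,\alpha>0$ such that $\|x(t)\|\le c e^{-\alpha t}\|x(0)\|$ for all $t\ge 0$ and all initial conditions $x(0)\in\mathbb{R}^n$. *)

(* Defs.v *)
From HB Require Import structures.
From mathcomp Require Import all_boot all_order all_algebra.
From mathcomp Require Import all_classical all_reals all_analysis.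

Set Implicit Arguments.
Unset Strict Implicit.
Unset Printing Implicit Defensive.

Import Order.TTheory GRing.Theory Num.Theory.
Import numFieldNormedType.Exports.

Local Open Scope classical_set_scope.
Local Open Scope ring_scope.

Definition posdef (R : realType) (p : nat) (M : 'M[R]_p) : Prop :=
  M^T = M /\ forall v : 'cV[R]_p, v != 0 -> 0 < (v^T *m M *m v) 0 0.

Definition possemidef (R : realType) (p : nat) (M : 'M[R]_p) : Prop :=
  M^T = M /\ forall v : 'cV[R]_p, 0 <= (v^T *m M *m v) 0 0.

Definition negdef (R : realType) (p : nat) (M : 'M[R]_p) : Prop :=
  posdef (- M).

(* Eigenvalues are counted with algebraic multiplicity.  The predicate is only
   meaningful when the characteristic polynomial splits over R, which is always
   the case for a symmetric matrix. *)
Definition num_pos_eigenvalues (R : realType) (p : nat) (M : 'M[R]_p)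
    (k : nat) : Prop :=
  exists2 rs : seq R, char_poly M = \prod_(z <- rs) ('X - z%:P)
                    & count (fun z => 0 < z) rs = k.

Definition enorm (R : realType) (n : nat) (v : 'cV[R]_n) : R :=
  Num.sqrt (\sum_(i < n) v i 0 ^+ 2).

Definition noise_mx (R : realType) (N md : nat) (Qd : 'M[R]_N)
    (Sd : 'M[R]_(N, md)) (Rd : 'M[R]_md) : 'M[R]_(N + md) :=
  block_mx Qd Sd Sd^T Rd.

Definition noise_set (R : realType) (N md : nat) (Qd : 'M[R]_N)
    (Sd : 'M[R]_(N, md)) (Rd : 'M[R]_md) : set 'M[R]_(md, N) :=
  [set D | possemidef ((col_mx D^T 1%:M)^T *m noise_mx Qd Sd Rd
                        *m col_mx D^T 1%:M)].

Definition Sigma_c (R : realType) (n m md N : nat)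
    (dX X : 'M[R]_(n, N)) (U : 'M[R]_(m, N)) (Bd : 'M[R]_(n, md))
    (Qd : 'M[R]_N) (Sd : 'M[R]_(N, md)) (Rd : 'M[R]_md)
    : set ('M[R]_n * 'M[R]_(n, m)) :=
  [set AB | exists2 D, noise_set Qd Sd Rd D
                     & dX = AB.1 *m X + AB.2 *m U + Bd *m D].

Definition Pc (R : realType) (n m md N : nat)
    (dX X : 'M[R]_(n, N)) (U : 'M[R]_(m, N)) (Bd : 'M[R]_(n, md))
    (Qd : 'M[R]_N) (Sd : 'M[R]_(N, md)) (Rd : 'M[R]_md)
    : 'M[R]_((n + m) + n) :=
  let L := block_mx (- col_mx X U) 0 dX Bd in
  L *m noise_mx Qd Sd Rd *m L^T.

(* With invmx M = [Q S; S^T R], where Q has size q and R has size p, this is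
   [-R S^T; S -Q]. *)
Definition tilde_mx (R : realType) (q p : nat) (M : 'M[R]_(q + p))
    : 'M[R]_(p + q) :=
  block_mx (- drsubmx (invmx M)) (ursubmx (invmx M))^T
           (ursubmx (invmx M)) (- ulsubmx (invmx M)).

Section LMI.
Variables (R : realType) (n m : nat).

Definition Pmx (P1 P2 P3 : 'M[R]_n) : 'M[R]_(n + n) := block_mx P1 0 P2 P3.

Definition PRmx (P1 P2 P3 R0 : 'M[R]_n) : 'M[R]_((n + n) + n) :=
  block_mx (Pmx P1 P2 P3) 0 0 R0.

Definition PR2mx (P1 P2 P3 R0 : 'M[R]_n) : 'M[R]_((n + n) + n, n + n) :=
  col_mx (Pmx P1 P2 P3) (row_mx 0 R0).

Definition Jmx : 'M[R]_(n + n) := block_mx 0 1%:M 0 (- 1%:M).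

Definition Emx : 'M[R]_((n + n) + n, n) := col_mx (col_mx 0 1%:M) 0.

Definition IKmx (K : 'M[R]_(m, n)) : 'M[R]_(n + m, n + n) := block_mx 1%:M 0 K 0.

(* [0 Y^T 0; Y 0 0; 0 0 lambda Pt], with p = 2n for the first inequality and
   p = 3n for the second. *)
Definition Wmx (p : nat) (Y : 'M[R]_((n + n) + n, p)) (lambda : R)
    (Pt : 'M[R]_(n + (n + m)))
    : 'M[R]_((p + ((n + n) + n)) + (n + (n + m))) :=
  block_mx (block_mx 0 Y^T Y 0) 0 0 (lambda *: Pt).

Definition F1 (K : 'M[R]_(m, n)) (h : R)
    : 'M[R]_(((n + n) + ((n + n) + n)) + (n + (n + m)), (n + n) + n) :=
  col_mx
    (block_mx 1%:M                               0
              (col_mx Jmx (row_mx 0 (h / 2)%:M)) Emx)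
    (block_mx 0                                  1%:M
              (IKmx K)                           0).

Definition F2 (K : 'M[R]_(m, n)) (h : R)
    : 'M[R]_((((n + n) + n) + ((n + n) + n)) + (n + (n + m)),
             ((n + n) + n) + n) :=
  col_mx
    (block_mx 1%:M                                        0
              (block_mx Jmx 0 0 (- (h / 2)%:M))           Emx)
    (block_mx 0                                           1%:M
              (row_mx (IKmx K) (col_mx 0 (- (h *: K))))   0).

End LMI.

Definition sampling_sequence (R : realType) (h : R) (ts : nat -> R) : Prop :=
  [/\ ts 0%N = 0,
      forall k, 0 < ts k.+1 - ts k <= h
    & ts @ \oo --> +oo].

(* x is only constrained on [0, +oo[; being continuous there, it has the
   right-hand derivative prescribed by the closed loop at the sampling
   instants, where u jumps and x need not be differentiable. *)
Definition sampled_trajectory (R : realType) (n m : nat) (A : 'M[R]_n)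
    (B : 'M[R]_(n, m)) (K : 'M[R]_(m, n)) (ts : nat -> R)
    (x : R -> 'cV[R]_n) : Prop :=
  {within `[0, +oo[, continuous x} /\
  exists2 u : R -> 'cV[R]_m,
    (forall k t, ts k <= t < ts k.+1 -> u t = K *m x (ts k)) &
    (forall k t, ts k < t < ts k.+1 ->
       is_derive t 1 x (A *m x t + B *m u t)).

Definition sampled_exp_stable (R : realType) (n m : nat) (A : 'M[R]_n)
    (B : 'M[R]_(n, m)) (K : 'M[R]_(m, n)) (ts : nat -> R) : Prop :=
  exists c alpha : R, [/\ 0 < c, 0 < alpha &
    forall x : R -> 'cV[R]_n, sampled_trajectory A B K ts x ->
    forall t : R, 0 <= t ->
      enorm (x t) <= c * expR (- alpha * t) * enorm (x 0)].

(* Main.v *)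
(** Dualizing the data: for (A, B) consistent with the data, the quadratic form
of [tilde_mx Pc] is nonnegative at every vector (A x + B w, x, w).  Evaluated at
such vectors, the convex combination of the two matrix inequalities with weights
1 - s and s, where s is the elapsed fraction of the longest sampling interval h,
becomes a dissipation inequality along the closed loop.  It makes the functional
  x^T P1 x + (T - tau) tau v^T R0 v,   v = (x (t_k + tau) - x (t_k)) / tau,
decay exponentially at a uniform rate on each sampling interval of length T;
its second term vanishes at both ends, so x^T P1 x decays from one sampling
instant to the next. *)

Require Import Defs.
From mathcomp Require Import all_boot all_order all_algebra.
From mathcomp Require Import all_classical all_reals all_analysis.
From mathcomp Require Import ring lra.
Import Order.TTheory GRing.Theory Num.Theory.
Import numFieldNormedType.Exports.
Local Open Scope classical_set_scope.
Local Open Scope ring_scope.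

Set Implicit Arguments.
Unset Strict Implicit.

(** * Algebra of the bilinear form of a matrix *)

Section BilinearForms.
Variable R : realType.

Definition bform (p q : nat) (M : 'M[R]_(p, q)) (u : 'cV[R]_p) (v : 'cV[R]_q) : R :=
  (u^T *m M *m v) 0 0.

Lemma bformE p q (M : 'M[R]_(p, q)) u v :
  bform M u v = \sum_i \sum_j u i 0 * M i j * v j 0.
Proof.
rewrite /bform mxE exchange_big /=; apply: eq_bigr => j _.
rewrite mxE mulr_suml; apply: eq_bigr => i _; by rewrite mxE.
Qed.

Lemma bformDl p q (M : 'M[R]_(p, q)) u1 u2 v :
  bform M (u1 + u2) v = bform M u1 v + bform M u2 v.
Proof. by rewrite /bform linearD /= !mulmxDl mxE. Qed.

Lemma bformDr p q (M : 'M[R]_(p, q)) u v1 v2 :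
  bform M u (v1 + v2) = bform M u v1 + bform M u v2.
Proof. by rewrite /bform mulmxDr mxE. Qed.

Lemma bformZl p q (M : 'M[R]_(p, q)) c u v :
  bform M (c *: u) v = c * bform M u v.
Proof. by rewrite /bform linearZ /= -!scalemxAl mxE. Qed.

Lemma bformZr p q (M : 'M[R]_(p, q)) c u v :
  bform M u (c *: v) = c * bform M u v.
Proof. by rewrite /bform -!scalemxAr mxE. Qed.

Lemma bformNl p q (M : 'M[R]_(p, q)) u v : bform M (- u) v = - bform M u v.
Proof. by rewrite -scaleN1r bformZl mulN1r. Qed.

Lemma bformNr p q (M : 'M[R]_(p, q)) u v : bform M u (- v) = - bform M u v.
Proof. by rewrite -scaleN1r bformZr mulN1r. Qed.

Lemma bform0l p q (M : 'M[R]_(p, q)) v : bform M 0 v = 0.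
Proof. by rewrite /bform trmx0 !mul0mx mxE. Qed.

Lemma bform0r p q (M : 'M[R]_(p, q)) u : bform M u 0 = 0.
Proof. by rewrite /bform !mulmx0 mxE. Qed.

Lemma bform0m p q (u : 'cV[R]_p) (v : 'cV[R]_q) : bform 0 u v = 0.
Proof. by rewrite /bform mulmx0 mul0mx mxE. Qed.

Lemma bformNm p q (M : 'M[R]_(p, q)) u v : bform (- M) u v = - bform M u v.
Proof. by rewrite /bform mulmxN mulNmx mxE. Qed.

Lemma bformZm p q (M : 'M[R]_(p, q)) c u v : bform (c *: M) u v = c * bform M u v.
Proof. by rewrite /bform -scalemxAr -scalemxAl mxE. Qed.

Lemma bform_tr p q (M : 'M[R]_(p, q)) u v : bform M^T v u = bform M u v.
Proof.
have -> : bform M u v = (u^T *m M *m v)^T 0 0 by rewrite mxE.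
by rewrite !trmx_mul trmxK mulmxA.
Qed.

Lemma bform_mul p q p' q' (X : 'M[R]_(p', p)) (M : 'M[R]_(p, q)) (Y : 'M[R]_(q, q')) u v :
  bform (X *m M *m Y) u v = bform M (X^T *m u) (Y *m v).
Proof. by rewrite /bform trmx_mul trmxK !mulmxA. Qed.

Lemma bform_col p1 p2 q (M1 : 'M[R]_(p1, q)) (M2 : 'M[R]_(p2, q)) u1 u2 v :
  bform (col_mx M1 M2) (col_mx u1 u2) v = bform M1 u1 v + bform M2 u2 v.
Proof. by rewrite /bform tr_col_mx mul_row_col mulmxDl mxE. Qed.

Lemma bform_row p q1 q2 (M1 : 'M[R]_(p, q1)) (M2 : 'M[R]_(p, q2)) u v1 v2 :
  bform (row_mx M1 M2) u (col_mx v1 v2) = bform M1 u v1 + bform M2 u v2.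
Proof. by rewrite /bform mul_mx_row mul_row_col mxE. Qed.

Lemma bform_block p1 p2 q1 q2 (M11 : 'M[R]_(p1, q1)) (M12 : 'M[R]_(p1, q2))
    (M21 : 'M[R]_(p2, q1)) (M22 : 'M[R]_(p2, q2)) u1 u2 v1 v2 :
  bform (block_mx M11 M12 M21 M22) (col_mx u1 u2) (col_mx v1 v2) =
  bform M11 u1 v1 + bform M12 u1 v2 + (bform M21 u2 v1 + bform M22 u2 v2).
Proof. by rewrite /block_mx bform_col !bform_row. Qed.

End BilinearForms.

(** * Positive definite forms and their comparison with the Euclidean norm *)

Section PositiveForms.
Variable R : realType.

(** The radicand of [enorm]: estimates stay quadratic, and roots are taken only at the very end. *)
Definition sqnorm (n : nat) (v : 'cV[R]_n) : R := \sum_i v i 0 ^+ 2.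

Lemma sqnorm_ge0 n (v : 'cV[R]_n) : 0 <= sqnorm v.
Proof. by apply: sumr_ge0 => i _; apply: sqr_ge0. Qed.

Lemma sqnorm_col n1 n2 (u : 'cV[R]_n1) (v : 'cV[R]_n2) :
  sqnorm (col_mx u v) = sqnorm u + sqnorm v.
Proof.
rewrite /sqnorm big_split_ord /=; congr (_ + _); apply: eq_bigr => i _.
  by rewrite col_mxEu.
by rewrite col_mxEd.
Qed.

Lemma posdef_bform n (M : 'M[R]_n) (v : 'cV[R]_n) : posdef M -> v != 0 -> 0 < bform M v v.
Proof. by case=> _; apply. Qed.

Lemma posdef_bform_ge0 n (M : 'M[R]_n) v : posdef M -> 0 <= bform M v v.
Proof.
move=> HM; have [->|v0] := eqVneq v 0; first by rewrite bform0l.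
exact/ltW/posdef_bform.
Qed.

Lemma posdef_sym n (M : 'M[R]_n) u v : posdef M -> bform M u v = bform M v u.
Proof. by move=> HM; rewrite -bform_tr HM.1. Qed.

(** With a = <u,u>, b = <u,v>, c = <v,v>, the form at c u - b v is c (a c - b^2), and c > 0 unless v
    = 0. *)
Lemma posdef_cauchy_schwarz n (M : 'M[R]_n) u v : posdef M ->
  bform M u v ^+ 2 <= bform M u u * bform M v v.
Proof.
move=> HM; have [->|v0] := eqVneq v 0; first by rewrite !bform0r mulr0 expr0n.
have vv := posdef_bform HM v0.
have := posdef_bform_ge0 (bform M v v *: u - bform M u v *: v) HM.
rewrite !(bformDl, bformDr, bformNl, bformNr, bformZl, bformZr) (posdef_sym v u HM).
set a := bform M u u; set b := bform M u v; set c := bform M v v in vv *.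
by move=> H; rewrite -subr_ge0 -(pmulr_rge0 _ vv); lra.
Qed.

Lemma posdef_young n (M : 'M[R]_n) u v : posdef M ->
  2 * bform M u v <= bform M u u + bform M v v.
Proof.
move=> HM; have := posdef_bform_ge0 (u - v) HM.
rewrite !(bformDl, bformDr, bformNl, bformNr) (posdef_sym v u HM); lra.
Qed.

Lemma posdef_unit n (M : 'M[R]_n) : posdef M -> M \in unitmx.
Proof.
move=> HM; rewrite unitmxE unitfE; apply/det0P => -[v v0 vM].
have : v^T != 0 by apply: contraNneq v0 => /(congr1 trmx); rewrite trmxK trmx0 => ->.
by move=> /(posdef_bform HM); rewrite /bform trmxK vM mul0mx mxE ltxx.
Qed.

(* By Cauchy-Schwarz v_i ^ 2 = <M^-1 e_i, v>_M ^ 2 <= (M^-1)_ii * v^T M v. *)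
Lemma posdef_coercive n (M : 'M[R]_n) : posdef M ->
  exists2 c : R, 0 < c & forall v, c * sqnorm v <= bform M v v.
Proof.
move=> HM; have uM := posdef_unit HM.
pose e (i : 'I_n) : 'cV[R]_n := invmx M *m delta_mx i 0.
pose S := \sum_i bform M (e i) (e i).
have S0 : 0 <= S by apply: sumr_ge0 => i _; exact: posdef_bform_ge0.
have H v : sqnorm v <= S * bform M v v.
  rewrite /S mulr_suml; apply: ler_sum => i _.
  have <- : bform M (e i) v = v i 0; last exact: posdef_cauchy_schwarz.
  rewrite /bform trmx_mul trmx_inv HM.1 -mulmxA -mulmxA mulKmx //.
  by rewrite trmx_delta -rowE mxE.
(* Only S >= 0 is known, so 1 is added before inverting. *)
exists (S + 1)^-1 => [|v]; first by rewrite invr_gt0; lra.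
rewrite mulrC ler_pdivrMr ?ltr_wpDl //; apply: le_trans (H v) _.
rewrite mulrC; apply: ler_wpM2l; [exact: posdef_bform_ge0 | lra].
Qed.

(** Each product v_i v_j is at most |v|^2 in absolute value, so the sum of the |M_ij| is a bound;
    adding 1 makes it positive even for M = 0. *)
Lemma bform_bounded n (M : 'M[R]_n) :
  exists2 c : R, 0 < c & forall v, bform M v v <= c * sqnorm v.
Proof.
have le_sqnorm (v : 'cV[R]_n) k : v k 0 ^+ 2 <= sqnorm v.
  by rewrite /sqnorm (bigD1 k) //= lerDl; apply: sumr_ge0 => ? _; exact: sqr_ge0.
exists (1 + \sum_i \sum_j `|M i j|).
  by rewrite ltr_wpDr //; do 2!apply: sumr_ge0 => ? _.
move=> v; rewrite bformE mulrDl mul1r ler_wpDl ?sqnorm_ge0 //.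
rewrite mulr_suml; apply: ler_sum => i _; rewrite mulr_suml; apply: ler_sum => j _.
apply: le_trans (ler_norm _) _; rewrite mulrAC normrM mulrC ler_wpM2l //.
have := le_sqnorm v i; have := le_sqnorm v j.
set a := v j 0; set b := v i 0; rewrite ler_norml; nra.
Qed.

End PositiveForms.

(** * From consistency with the data to nonnegativity of the dual form *)

Section DataConsistency.
Variable R : realType.

(** [tilde_mx M] is minus the inverse of M, seen through the block swap with sign (a, xi) -> (xi,
    -a). *)
Lemma bform_tilde_mx q p (M : 'M[R]_(q + p)) (a : 'cV[R]_p) (xi : 'cV[R]_q) :
  M^T = M ->
  bform (tilde_mx M) (col_mx a xi) (col_mx a xi) =
  - bform (invmx M) (col_mx xi (- a)) (col_mx xi (- a)).
Proof.
move=> symM; have symV : (invmx M)^T = invmx M by rewrite trmx_inv symM.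
rewrite -[X in - bform X _ _]submxK !bform_block -[dlsubmx _]trmxK.
rewrite trmx_dlsub symV !bform_tr !bformNm !(bformNl, bformNr); ring.
Qed.

(* With V = [M^T; I], the vector z = P^-1 (xi, - M xi) satisfies V^T P z = 0;
   eliminating its lower block by subtracting a vector of the range of V, on
   which P is nonnegative, leaves only the upper left block of P. *)
Lemma tilde_mx_ge0 q p (P : 'M[R]_(q + p)) (M : 'M[R]_(p, q)) (xi : 'cV[R]_q) :
  P \in unitmx -> P^T = P ->
  (forall v : 'cV[R]_p, 0 <= bform P (col_mx (M^T *m v) v) (col_mx (M^T *m v) v)) ->
  (forall e : 'cV[R]_q, bform P (col_mx e 0) (col_mx e 0) <= 0) ->
  0 <= bform (tilde_mx P) (col_mx (M *m xi) xi) (col_mx (M *m xi) xi).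
Proof.
move=> uP symP posV negQ; rewrite bform_tilde_mx // oppr_ge0.
set w := col_mx xi _; pose z := invmx P *m w; pose b := dsubmx z.
pose Vb := col_mx (M^T *m b) b.
have orth : bform P Vb z = 0.
  rewrite /bform -mulmxA mulKVmx // /Vb tr_col_mx mul_row_col trmx_mul trmxK.
  by rewrite mulmxN -mulmxA subrr mxE.
have orth' : bform P z Vb = 0 by rewrite -bform_tr symP.
have -> : bform (invmx P) w w = bform P z z.
  by rewrite /bform /z -!mulmxA mulKVmx // trmx_mul trmx_inv symP mulmxA.
have zE : z = col_mx (usubmx z - M^T *m b) 0 + Vb.
  by rewrite add_col_mx subrK add0r vsubmxK.
(* As the cross terms vanish, the form at z - Vb is the sum of those at z and at Vb. The sum is <= 0
   and the part at Vb is >= 0, which forces the part at z to be <= 0. *)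
have := negQ (usubmx z - M^T *m b); have := posV b; rewrite -/Vb => h1.
have -> : col_mx (usubmx z - M^T *m b) 0 = z - Vb by apply/eqP; rewrite eq_sym subr_eq; apply/eqP.
rewrite !(bformDl, bformDr, bformNl, bformNr) orth orth'; lra.
Qed.

Variables (n m md N : nat) (dX X : 'M[R]_(n, N)) (U : 'M[R]_(m, N))
  (Bd : 'M[R]_(n, md)) (Qd : 'M[R]_N) (Sd : 'M[R]_(N, md)) (Rd : 'M[R]_md).
Hypotheses (Qd_sym : Qd^T = Qd) (Rd_sym : Rd^T = Rd) (Qd_neg : negdef Qd).
Let P := Pc dX X U Bd Qd Sd Rd.

Lemma Pc_sym : P^T = P.
Proof.
rewrite /P /Pc /noise_mx; set L := block_mx _ _ dX _.
by rewrite !trmx_mul trmxK mulmxA (tr_block_mx Qd) trmxK Qd_sym Rd_sym.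
Qed.

(** The upper left block of P is Z Qd Z^T with Z = [X; U], and Qd is negative definite. *)
Lemma Pc_upper_le0 (e : 'cV[R]_(n + m)) : bform P (col_mx e 0) (col_mx e 0) <= 0.
Proof.
rewrite /P /Pc bform_mul tr_block_mx !mul_block_col !mulmx0 !addr0 trmx0 mul0mx.
rewrite /noise_mx bform_block !bform0l !bform0r !addr0.
by rewrite -oppr_ge0 -bformNm; apply: posdef_bform_ge0.
Qed.

(** Since dX - A X - B U = Bd D, the outer factor of [Pc] sends the vector to [D^T; I] Bd^T v, where
    the noise inequality for D applies. *)
Lemma Sigma_c_ge0 A B (v : 'cV[R]_n) : Sigma_c dX X U Bd Qd Sd Rd (A, B) ->
  let w := col_mx ((row_mx A B)^T *m v) v in 0 <= bform P w w.
Proof.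
case=> D [_ noiseD] /= dXE; rewrite /P /Pc bform_mul tr_block_mx mul_block_col trmx0 mul0mx add0r.
have -> : (- col_mx X U)^T *m ((row_mx A B)^T *m v) + dX^T *m v = D^T *m (Bd^T *m v).
  rewrite !mulmxA -mulmxDl; congr (_ *m _); rewrite -!trmx_mul -linearD /=; congr (_^T).
  by rewrite mulmxN mul_row_col dXE addrC [in LHS]addrC addKr.
have -> : col_mx (D^T *m (Bd^T *m v)) (Bd^T *m v) = col_mx D^T 1%:M *m (Bd^T *m v).
  by rewrite mul_col_mx mul1mx.
by apply: le_trans (noiseD (Bd^T *m v)) _; rewrite -[leLHS]/(bform _ _ _) bform_mul trmxK.
Qed.

Lemma Sigma_c_tilde_ge0 A B (xi : 'cV[R]_(n + m)) : P \in unitmx ->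
  Sigma_c dX X U Bd Qd Sd Rd (A, B) ->
  let w := col_mx (row_mx A B *m xi) xi in 0 <= bform (tilde_mx P) w w.
Proof.
move=> uP AB; apply: tilde_mx_ge0 => //; [exact: Pc_sym | | exact: Pc_upper_le0].
by move=> v; exact: Sigma_c_ge0 AB.
Qed.

End DataConsistency.

(** * The matrix inequalities as a dissipation inequality *)

Section DelayLMI.
Variables (R : realType) (n m : nat).
Implicit Types (Pt : 'M[R]_(n + (n + m))) (x y v d : 'cV[R]_n).

Lemma bform_Wmx p (Y : 'M[R]_((n + n) + n, p)) l Pt a b c :
  bform (Wmx Y l Pt) (col_mx (col_mx a b) c) (col_mx (col_mx a b) c) =
  2 * bform Y b a + l * bform Pt c c.
Proof.
rewrite /Wmx !bform_block !bform0m bform_tr bformZm; ring.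
Qed.

Lemma bform_Pmx P1 P2 P3 y z x1 x2 :
  bform (Pmx P1 P2 P3) (col_mx y z) (col_mx x1 x2) =
  bform P1 y x1 + bform P2 z x1 + bform P3 z x2.
Proof. rewrite /Pmx bform_block bform0m; ring. Qed.

(** Here y stands for the derivative of x, and d for A x + B K x, the closed loop just after
    sampling. The multipliers P2, P3 act on the slack d - y, and q is then a vector of the dual data
    inequality. *)
Lemma F1_bform K h P1 P2 P3 (R0 : 'M[R]_n) l Pt x y d :
  let w := col_mx (col_mx x y) d in
  let q := col_mx d (col_mx x (K *m x)) in
  bform ((F1 K h)^T *m Wmx (PR2mx P1 P2 P3 R0) l Pt *m F1 K h) w w =
  2 * (bform P1 y x + bform P2 (d - y) x + bform P3 (d - y) y) + h * bform R0 y y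
  + l * bform Pt q q.
Proof.
move=> w q; rewrite bform_mul trmxK.
have -> : F1 K h *m w = col_mx (col_mx (col_mx x y)
    (col_mx (col_mx y (d - y)) ((h / 2) *: y))) q.
  rewrite /F1 /w mul_col_mx !mul_block_col !mul1mx !mul0mx ?addr0 ?add0r.
  rewrite /Jmx /Emx !mul_col_mx !mul_row_col !mul0mx !mulNmx !mul1mx mul_scalar_mx ?addr0 ?add0r.
  by rewrite !add_col_mx ?addr0 addrC.
rewrite bform_Wmx /PR2mx bform_col bform_Pmx bform_row bform0m bformZl; by field.
Qed.

(** The counterpart for elapsed time h: with v the mean slope since sampling, x - h v is the sampled
    state, so q carries the held input. *)
Lemma F2_bform K h P1 P2 P3 (R0 : 'M[R]_n) l Pt x y v d :
  let w := col_mx (col_mx (col_mx x y) v) d in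
  let q := col_mx d (col_mx x (K *m x - h *: (K *m v))) in
  bform ((F2 K h)^T *m Wmx (PRmx P1 P2 P3 R0) l Pt *m F2 K h) w w =
  2 * (bform P1 y x + bform P2 (d - y) x + bform P3 (d - y) y) - h * bform R0 v v
  + l * bform Pt q q.
Proof.
move=> w q; rewrite bform_mul trmxK.
have -> : F2 K h *m w = col_mx (col_mx (col_mx (col_mx x y) v)
    (col_mx (col_mx y (d - y)) (- (h / 2) *: v))) q.
  rewrite /F2 /w mul_col_mx !mul_block_col !mul1mx !mul0mx ?addr0 ?add0r.
  rewrite /Emx !mul_col_mx !mul_row_col mul_block_col mul_col_mx.
  rewrite !mulNmx !mul1mx !mul0mx mul_scalar_mx -scalemxAl !scaleNr ?addr0 ?add0r.
  by rewrite !add_col_mx !addr0 [- y + d]addrC.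
rewrite bform_Wmx /PRmx bform_block !bform0m bform_Pmx bformZl; by field.
Qed.

(* Weighting the two inequalities, written for the derivatives d1 and d2 at the
   two ends of the sampling interval, by 1 - s and s and taking the derivative
   y = (1 - s) d1 + s d2 cancels the multipliers P2 and P3. *)
Lemma delay_lmi_decay K h P1 P2 P3 (R0 : 'M[R]_n) l1 l2 Pt (A : 'M[R]_n) B :
  0 < l1 -> 0 < l2 ->
  (forall xi : 'cV[R]_(n + m), let q := col_mx (row_mx A B *m xi) xi in 0 <= bform Pt q q) ->
  negdef ((F1 K h)^T *m Wmx (PR2mx P1 P2 P3 R0) l1 Pt *m F1 K h) ->
  negdef ((F2 K h)^T *m Wmx (PRmx P1 P2 P3 R0) l2 Pt *m F2 K h) ->
  exists2 eps : R, 0 < eps & forall s x v y, 0 <= s <= 1 ->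
    y = A *m x + B *m (K *m x - (s * h) *: (K *m v)) ->
    2 * bform P1 y x + (1 - s) * h * bform R0 y y - s * h * bform R0 v v
      <= - (eps * (sqnorm x + s * sqnorm v)).
Proof.
move=> l1_gt0 l2_gt0 q_ge0 /posdef_coercive[c1 c1_gt0 H1] /posdef_coercive[c2 c2_gt0 H2].
exists (Num.min c1 c2) => [|s x v y /andP[s_ge0 s_le1] y_def]; first by rewrite lt_min c1_gt0.
pose d1 := A *m x + B *m (K *m x).
pose d2 := A *m x + B *m (K *m x - h *: (K *m v)).
(* The closed loop is affine in s, with values d1 at s = 0 and d2 at s = 1. *)
have yE : y = (1 - s) *: d1 + s *: d2.
  have shiftE c : A *m x + B *m (K *m x - c *: (K *m v)) = d1 - c *: (B *m (K *m v)).
    by rewrite mulmxBr -scalemxAr addrA.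
  by rewrite y_def /d2 !shiftE scalerBr addrA -scalerDl subrK scale1r scalerA.
have q1 : 0 <= bform Pt (col_mx d1 (col_mx x (K *m x))) (col_mx d1 (col_mx x (K *m x))).
  by have := q_ge0 (col_mx x (K *m x)); rewrite /= mul_row_col.
have q2 : 0 <= bform Pt (col_mx d2 (col_mx x (K *m x - h *: (K *m v))))
                        (col_mx d2 (col_mx x (K *m x - h *: (K *m v)))).
  by have := q_ge0 (col_mx x (K *m x - h *: (K *m v))); rewrite /= mul_row_col.
have := H1 (col_mx (col_mx x y) d1); rewrite bformNm F1_bform !sqnorm_col => {}H1.
have := H2 (col_mx (col_mx (col_mx x y) v) d2); rewrite bformNm F2_bform !sqnorm_col => {}H2.
set c := Num.min c1 c2.
have c_ge0 : 0 <= c by rewrite le_min !ltW.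
have {}H1 : 2 * (bform P1 y x + bform P2 (d1 - y) x + bform P3 (d1 - y) y)
    + h * bform R0 y y + c * sqnorm x <= 0.
  have := mulr_ge0 (ltW l1_gt0) q1; have := mulr_ge0 (ltW c1_gt0) (sqnorm_ge0 y).
  have := mulr_ge0 (ltW c1_gt0) (sqnorm_ge0 d1).
  have : c * sqnorm x <= c1 * sqnorm x by rewrite ler_wpM2r ?sqnorm_ge0 // ge_min lexx.
  lra.
have {}H2 : 2 * (bform P1 y x + bform P2 (d2 - y) x + bform P3 (d2 - y) y)
    - h * bform R0 v v + c * (sqnorm x + sqnorm v) <= 0.
  have := mulr_ge0 (ltW l2_gt0) q2; have := mulr_ge0 (ltW c2_gt0) (sqnorm_ge0 y).
  have := mulr_ge0 (ltW c2_gt0) (sqnorm_ge0 d2).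
  have : c * (sqnorm x + sqnorm v) <= c2 * (sqnorm x + sqnorm v).
    by rewrite ler_wpM2r ?addr_ge0 ?sqnorm_ge0 // ge_min lexx orbT.
  lra.
have s'_ge0 : 0 <= 1 - s by lra.
have := mulr_ge0_le0 s'_ge0 H1; have := mulr_ge0_le0 s_ge0 H2.
have E z (Q : 'M[R]_n) : bform Q y z = (1 - s) * bform Q d1 z + s * bform Q d2 z.
  by rewrite yE bformDl !bformZl.
rewrite !(bformDl _ _ (- y)) !bformNl.
rewrite (E x P2) (E y P3); lra.
Qed.

End DelayLMI.

(** * Derivatives and limits of bilinear forms, and a Gronwall estimate *)

Section BilinearCalculus.
Variable R : realType.

Lemma is_derive_coord p q (x : R -> 'M[R]_(p, q)) (t : R) (dx : 'M[R]_(p, q)) i j :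
  is_derive t 1 x dx -> is_derive t 1 (fun s => x s i j) (dx i j).
Proof.
move=> x_dx; have x_der := @ex_derive _ _ _ _ _ _ _ x_dx; split.
  exact: (derivable_mxP _ _ _).1.
by have := @derive_val _ _ _ _ _ _ _ x_dx; rewrite derive_mx // => <-; rewrite mxE.
Qed.

Lemma is_derive_bform p q (M : 'M[R]_(p, q)) (x : R -> 'cV[R]_p) (y : R -> 'cV[R]_q)
    (t : R) (dx : 'cV[R]_p) (dy : 'cV[R]_q) :
  is_derive t 1 x dx -> is_derive t 1 y dy ->
  is_derive t 1 (fun s => bform M (x s) (y s)) (bform M dx (y t) + bform M (x t) dy).
Proof.
move=> x_dx y_dy.
have -> : (fun s => bform M (x s) (y s)) =
    \sum_(i < p) \sum_(j < q) (M i j *: ((fun s => x s i 0) * (fun s => y s j 0))).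
  apply/funext => s; rewrite bformE fct_sumE; apply: eq_bigr => i _.
  rewrite fct_sumE; apply: eq_bigr => j _.
  by rewrite -[RHS]/(M i j * (x s i 0 * y s j 0)) mulrA (mulrC (M i j)).
have D i j : is_derive t 1 (M i j *: ((fun s => x s i 0) * (fun s => y s j 0)))
    (M i j *: (x t i 0 *: dy j 0 + y t j 0 *: dx i 0)).
  by apply: is_deriveZ; apply: is_deriveM; apply: is_derive_coord.
apply: is_derive_eq.
rewrite !bformE -big_split; apply: eq_bigr => i _; rewrite -big_split; apply: eq_bigr => j _ /=.
rewrite /GRing.scale /=; ring.
Qed.

Lemma cvg_bform p q (M : 'M[R]_(p, q)) (T : Type) (F : set_system T) {FF : ProperFilter F}
    (x : T -> 'cV[R]_p) (y : T -> 'cV[R]_q) a b :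
  x @ F --> a -> y @ F --> b -> bform M (x s) (y s) @[s --> F] --> bform M a b.
Proof.
move=> xa yb; under eq_fun do rewrite bformE; rewrite bformE.
apply: cvg_big => [|i _]; first exact: add_continuous.
apply: cvg_big => [|j _]; first exact: add_continuous.
apply: cvgM; first apply: cvgM.
- exact: (cvg_comp _ _ xa (@coord_continuous _ _ _ i 0 a)).
- exact: cvg_cst.
- exact: (cvg_comp _ _ yb (@coord_continuous _ _ _ j 0 b)).
Qed.

(** The mean value theorem for expR (alpha t) f(t), whose derivative is <= 0. Differentiability is
    asked only inside the interval, since trajectories may have corners at sampling instants. *)
Lemma gronwall_decay (f df : R -> R) a b alpha : a <= b ->
  {within `[a, b], continuous f} ->
  (forall t, t \in `]a, b[ -> is_derive t 1 f (df t)) ->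
  (forall t, t \in `]a, b[ -> df t <= - alpha * f t) ->
  f b <= expR (- alpha * (b - a)) * f a.
Proof.
rewrite le_eqVlt => /predU1P[-> *|ab f_cont f_df df_le].
  by rewrite subrr mulr0 expR0 mul1r.
pose g (t : R) := expR (alpha * t) * f t.
have expD (t : R) : is_derive t 1 (fun s => expR (alpha * s)) (expR (alpha * t) * alpha).
  apply: (is_derive1_comp (f := expR) (g := fun s => alpha * s)).
  have : is_derive t 1 (alpha *: (id : R -> R)) (alpha *: 1) by apply: is_deriveZ.
  by rewrite [_ *: 1]mulr1.
have g_dg t : t \in `]a, b[ -> is_derive t 1 g (expR (alpha * t) * (alpha * f t + df t)).
  move=> tab; have fD := f_df t tab.
  have := is_deriveM (expD t) fD.
  rewrite /GRing.scale /=; set z := (X in is_derive _ _ _ X -> _).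
  suff -> : z = expR (alpha * t) * (alpha * f t + df t) by [].
  rewrite /z; ring.
have g_cont : {within `[a, b], continuous g}.
  move=> t; apply: cvgM; last exact: f_cont.
  apply: (continuous_subspaceT (f := fun s => expR (alpha * s))) => s.
  exact/differentiable_continuous/derivable1_diffP.
have [c cab] := MVT ab g_dg g_cont.
have : expR (alpha * c) * (alpha * f c + df c) * (b - a) <= 0.
  rewrite -mulrA pmulr_rle0 ?expR_gt0 // pmulr_lle0 ?subr_gt0 //.
  by have := df_le c cab; lra.
move=> /[swap] <-; rewrite subr_le0 /g => gba.
have -> : - alpha * (b - a) = - (alpha * b) + alpha * a by ring.
by rewrite expRD expRN -mulrA ler_pdivlMl ?expR_gt0.
Qed.

End BilinearCalculus.

(** * Decay along trajectories of the sampled closed loop *)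

Section SampledDecay.
Variables (R : realType) (n m : nat).

(* The functional W adds to x^T P1 x the term (b - t) (t - a) v^T R0 v, where
   v = (x t - x a) / (t - a); it vanishes at both ends of [a, b], at a because
   x is differentiable there from the right. *)
Lemma sampling_interval_decay (A : 'M[R]_n) (B : 'M[R]_(n, m)) (K : 'M[R]_(m, n))
    (P1 R0 : 'M[R]_n) (h eps c1 c2 alpha a b : R) (x : R -> 'cV[R]_n) :
  posdef P1 -> posdef R0 -> a < b -> b - a <= h ->
  (forall s x v y, 0 <= s <= 1 ->
    y = A *m x + B *m (K *m x - (s * h) *: (K *m v)) ->
    2 * bform P1 y x + (1 - s) * h * bform R0 y y - s * h * bform R0 v v
      <= - (eps * (sqnorm x + s * sqnorm v))) ->
  (forall v, bform P1 v v <= c1 * sqnorm v) ->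
  (forall v, bform R0 v v <= c2 * sqnorm v) ->
  0 <= c1 -> 0 <= c2 -> 0 <= alpha -> alpha * (c1 + c2 * h ^+ 2) <= eps ->
  {within `[a, b], continuous x} ->
  (forall t, t \in `]a, b[ -> is_derive t 1 x (A *m x t + B *m (K *m x a))) ->
  bform P1 (x b) (x b) <= expR (- alpha * (b - a)) * bform P1 (x a) (x a).
Proof.
move=> P1_pos R0_pos ab bah decay P1_le R0_le c1_ge0 c2_ge0 al_ge0 al_le x_cont x_der.
have [x_oo x_a x_b] := (continuous_within_itvP _ ab).1 x_cont.
pose e (t : R) : 'cV[R]_n := x t - x a.
pose w (t : R) : 'cV[R]_n := A *m x t + B *m (K *m x a).
pose r t := bform R0 (e t) (e t).
pose dr t := bform R0 (w t) (e t) + bform R0 (e t) (w t).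
(* The second term (b - t) (t - a) v^T R0 v equals ((b - a) / (t - a) - 1) r, which isolates the
   singular quotient r / (t - a); at t = a its numerator is 0. *)
pose W t := bform P1 (x t) (x t) - r t + (b - a) * (r t / (t - a)).
pose dW t := bform P1 (w t) (x t) + bform P1 (x t) (w t) - dr t
  + (b - a) * (dr t / (t - a) - r t / (t - a) ^+ 2).
have r_dr t : t \in `]a, b[ -> is_derive t 1 r (dr t).
  move=> tab; have e_w : is_derive t 1 e (w t).
    rewrite -[w t]subr0; apply: is_deriveB; exact: x_der.
  exact: is_derive_bform.
have id_der (t : R) : is_derive t 1 (fun s => s - a) 1.
  by rewrite -[X in is_derive _ _ _ X]subr0; apply: is_deriveB.
have W_dW t : t \in `]a, b[ -> is_derive t 1 W (dW t).
  move=> tab; have xD := x_der t tab; have rD := r_dr t tab.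
  have ta0 : t - a != 0 by rewrite subr_eq0 gt_eqF //; move: tab; rewrite in_itv /= => /andP[].
  have VD : is_derive t 1 (fun s => (s - a)^-1) (- (t - a) ^- 2 *: 1).
    exact: is_deriveV.
  have PD := is_derive_bform P1 xD xD.
  have := is_deriveD (is_deriveB PD rD) (is_deriveZ (b - a) (is_deriveM rD VD)).
  set z := (X in is_derive _ _ _ X -> _); suff -> : z = dW t by [].
  by rewrite /z /dW /GRing.scale /= /w; field.
have e_a0 : e t @[t --> a^'+] --> (0 : 'cV[R]_n).
  by rewrite -(subrr (x a)); apply: cvgB x_a _; exact: cvg_cst.
have cvg_w_e : bform R0 (w t) (e t) @[t --> a^'+] --> (0 : R).
  (* Absorbing A into the matrix leaves forms in x t and e t, whose limits are known. *)
  have wE t : bform R0 (w t) (e t) =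
      bform (A^T *m R0) (x t) (e t) + bform R0 (B *m (K *m x a)) (e t).
    by rewrite bformDl -[_ *m R0]mulmx1 bform_mul trmxK mul1mx.
  under eq_fun do rewrite wE.
  have -> : (0 : R) = bform (A^T *m R0) (x a) 0 + bform R0 (B *m (K *m x a)) 0.
    by rewrite !bform0r addr0.
  by apply: cvgD; apply: cvg_bform => //; exact: cvg_cst.
have r_to0 : r t @[t --> a^'+] --> 0.
  have -> : (0 : R) = bform R0 0 0 by rewrite bform0l.
  exact: cvg_bform.
have id_cvg (c : R) (F : set_system R) : Filter F -> F --> c -> t - a @[t --> F] --> c - a.
  by move=> FF Fc; apply: (cvgB (f := id)) => //; exact: cvg_cst.
(* By L'Hopital's rule, since dr is linear in e, which tends to 0. This gives the continuity of W at
   a. *)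
have r_a0 : r t / (t - a) @[t --> a^'+] --> 0.
  apply: (lhopital_at_right ab r_dr (fun t _ => id_der t)).
  - exact: r_to0.
  - by rewrite -(subrr a); apply: id_cvg; exact: cvg_at_right_filter cvg_id.
  - by move=> t _; exact: oner_neq0.
  - under eq_fun do rewrite divr1.
    under eq_fun do rewrite /dr (posdef_sym _ (w _) R0_pos).
    have -> : (0 : R) = 0 + 0 by rewrite addr0.
    exact: cvgD.
have W_cont : {within `[a, b], continuous W}.
  apply/(continuous_within_itvP _ ab); split.
  - move=> t tab; have WD := W_dW t tab.
    exact/differentiable_continuous/derivable1_diffP.
  - have -> : W a = bform P1 (x a) (x a) - 0 + (b - a) * 0.
      by rewrite /W /r /e subrr bform0l mul0r.
    apply: cvgD; first by apply: cvgB => //; exact: cvg_bform.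
    by apply: cvgMr.
  - have r_b : r t @[t --> b^'-] --> r b.
      by apply: cvg_bform; apply: cvgB => //; exact: cvg_cst.
    apply: cvgD; first by apply: cvgB => //; exact: cvg_bform.
    apply: cvgMr; apply: cvgM => //; apply: cvgV; first by rewrite subr_eq0 gt_eqF.
    by apply: id_cvg; exact: cvg_at_left_filter cvg_id.
have W_decay t : t \in `]a, b[ -> dW t <= - alpha * W t.
  rewrite in_itv /= => /andP[lt_at tb].
  pose tau := t - a; pose v := tau^-1 *: e t.
  have tau_gt0 : 0 < tau by rewrite subr_gt0.
  have h_gt0 : 0 < h by lra.
  have eE : e t = tau *: v by rewrite scalerA divff ?scale1r ?gt_eqF.
  have rE : r t = tau ^+ 2 * bform R0 v v by rewrite /r eE bformZl bformZr; ring.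
  have drE : dr t = 2 * tau * bform R0 (w t) v.
    by rewrite /dr (posdef_sym (e t) _ R0_pos) eE bformZr; ring.
  have s01 : 0 <= tau / h <= 1.
    apply/andP; split; first by rewrite divr_ge0 // ltW.
    by rewrite ler_pdivrMr // mul1r /tau; lra.
  (* The held state is x a = x t - tau v, so the dissipation inequality applies with s = tau / h. *)
  have wE : w t = A *m x t + B *m (K *m x t - (tau / h * h) *: (K *m v)).
    by rewrite divfK ?gt_eqF // scalemxAr -eE -mulmxBr subKr.
  have := decay _ _ _ _ s01 wE.
  rewrite mulrBl mul1r divfK ?gt_eqF //.
  have cross : 2 * bform R0 (w t) v <= bform R0 (w t) (w t) + bform R0 v v by exact: posdef_young.
  have btE : b - t = b - a - tau by rewrite /tau; ring.
  have WE : W t = bform P1 (x t) (x t) + (b - t) * tau * bform R0 v v.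
    by rewrite btE /W rE -/tau; field; rewrite gt_eqF.
  have dWE : dW t = 2 * bform P1 (w t) (x t) - (b - a) * bform R0 v v
      + (b - t) * (2 * bform R0 (w t) v).
    rewrite btE /dW rE drE -/tau (posdef_sym (x t) _ P1_pos).
    by field; rewrite gt_eqF.
  set Nx := sqnorm (x t); set Nv := sqnorm v; set s := tau / h => dec.
  have Nx_ge0 : 0 <= Nx := sqnorm_ge0 _.
  have Nv_ge0 : 0 <= Nv := sqnorm_ge0 _.
  have s_ge0 : 0 <= s by case/andP: s01.
  have tau_s : tau = s * h by rewrite divfK // gt_eqF.
  have bt_ge0 : 0 <= b - t by rewrite subr_ge0 ltW.
  (* Young's inequality, weighted by b - t, turns -(b - a) v^T R0 v plus the cross term into at most
     (b - t) w^T R0 w - tau v^T R0 v; then b - t <= h - tau. *)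
  have dW_le : dW t <= - (eps * (Nx + s * Nv)).
    apply: le_trans _ dec; rewrite dWE.
    have -> : b - a = b - t + tau by rewrite btE subrK.
    have hbt : 0 <= h - tau - (b - t) by rewrite btE; lra.
    have := mulr_ge0 hbt (posdef_bform_ge0 (w t) R0_pos).
    have := ler_wpM2l bt_ge0 cross; lra.
  (* The dissipation in v carries the weight s, and so does W: (b - t) tau <= h tau = h^2 s. *)
  have alW_le : alpha * W t <= eps * (Nx + s * Nv).
    apply: le_trans (_ : alpha * (c1 + c2 * h ^+ 2) * (Nx + s * Nv) <= _); last first.
      by rewrite ler_wpM2r // addr_ge0 // mulr_ge0.
    rewrite -mulrA ler_wpM2l // WE.
    have le_v : (b - t) * tau * bform R0 v v <= c2 * h ^+ 2 * (s * Nv).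
      apply: le_trans (_ : h * tau * (c2 * Nv) <= _); last by rewrite tau_s; lra.
      apply: ler_pM; [exact: mulr_ge0 bt_ge0 (ltW tau_gt0) | exact: posdef_bform_ge0 | | exact: R0_le].
      by rewrite ler_wpM2r ?(ltW tau_gt0) //; rewrite btE; lra.
    have := mulr_ge0 (mulr_ge0 c2_ge0 (sqr_ge0 h)) Nx_ge0.
    have := mulr_ge0 c1_ge0 (mulr_ge0 s_ge0 Nv_ge0).
    have := P1_le (x t); rewrite -/Nx; lra.
  lra.
have := gronwall_decay (ltW ab) W_cont W_dW W_decay.
have -> : W a = bform P1 (x a) (x a) by rewrite /W /r /e subrr bform0l; ring.
suff -> : W b = bform P1 (x b) (x b) by [].
by rewrite /W mulrCA divff ?mulr1 ?subrK // subr_eq0 gt_eqF.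
Qed.

(** Induction on the sampling intervals, the exponential factors multiplying up. The interval
    estimate holds for any length up to h, so the last interval is cut off at the time in question
    and no separate bound between sampling instants is needed. *)
Lemma sampled_trajectory_decay (A : 'M[R]_n) (B : 'M[R]_(n, m)) (K : 'M[R]_(m, n))
    (P1 R0 : 'M[R]_n) (h eps c1 c2 alpha : R) (ts : nat -> R) (x : R -> 'cV[R]_n) :
  posdef P1 -> posdef R0 ->
  (forall s x v y, 0 <= s <= 1 ->
    y = A *m x + B *m (K *m x - (s * h) *: (K *m v)) ->
    2 * bform P1 y x + (1 - s) * h * bform R0 y y - s * h * bform R0 v v
      <= - (eps * (sqnorm x + s * sqnorm v))) ->
  (forall v, bform P1 v v <= c1 * sqnorm v) ->
  (forall v, bform R0 v v <= c2 * sqnorm v) ->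
  0 <= c1 -> 0 <= c2 -> 0 <= alpha -> alpha * (c1 + c2 * h ^+ 2) <= eps ->
  sampling_sequence h ts -> sampled_trajectory A B K ts x ->
  forall t, 0 <= t -> bform P1 (x t) (x t) <= expR (- alpha * t) * bform P1 (x 0) (x 0).
Proof.
move=> P1_pos R0_pos decay P1_le R0_le c1_ge0 c2_ge0 al_ge0 al_le [ts0 ts_step ts_oo].
case=> x_cont [u uE x_der] t t_ge0.
have ts_ge0 k : 0 <= ts k.
  by elim: k => [|k IH]; [rewrite ts0 | have /andP[] := ts_step k; lra].
(* Divergence of the sampling instants ensures that finitely many intervals cover [0, t]. *)
have [N tN] : exists N, t < ts N.
  have /cvgryPgt/(_ t) := ts_oo; exact: filter_ex.
suff H k s : 0 <= s <= ts k ->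
    bform P1 (x s) (x s) <= expR (- alpha * s) * bform P1 (x 0) (x 0).
  by apply: (H N); rewrite t_ge0 ltW.
elim: k s => [|k IH] s /andP[s_ge0 s_le].
  have -> : s = 0 by apply: le_anti; rewrite s_ge0 andbT -{1}ts0.
  by rewrite mulr0 expR0 mul1r.
have [s_k|k_s] := leP s (ts k); first by apply: IH; rewrite s_ge0.
have /andP[_ step_le] := ts_step k.
have sk_le : s - ts k <= h by lra.
have cont : {within `[ts k, s], continuous x}.
  apply: continuous_subspaceW x_cont => z /=; rewrite !in_itv /= andbT => /andP[kz _].
  exact: le_trans (ts_ge0 k) kz.
have der z : z \in `]ts k, s[ -> is_derive z 1 x (A *m x z + B *m (K *m x (ts k))).
  rewrite in_itv /= => /andP[kz zs].
  have zk : z < ts k.+1 := lt_le_trans zs s_le.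
  by rewrite -(uE k z) ?(ltW kz) //; apply: (x_der k); rewrite kz.
apply: le_trans (sampling_interval_decay P1_pos R0_pos k_s sk_le decay P1_le R0_le
  c1_ge0 c2_ge0 al_ge0 al_le cont der) _.
have -> : - alpha * s = - alpha * (s - ts k) + - alpha * ts k by ring.
rewrite expRD -mulrA ler_wpM2l ?expR_ge0 //.
by apply: IH; rewrite ts_ge0 lexx.
Qed.

End SampledDecay.

(** * Exponential stability from the decay of x^T P1 x *)

Unset Implicit Arguments.

Theorem theorem4 (R : realType) (n m md N : nat)
    (n_gt0 : (0 < n)%N) (m_gt0 : (0 < m)%N) (md_gt0 : (0 < md)%N)
    (N_gt0 : (0 < N)%N)
    (dX X : 'M[R]_(n, N)) (U : 'M[R]_(m, N)) (Bd : 'M[R]_(n, md))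
    (Qd : 'M[R]_N) (Sd : 'M[R]_(N, md)) (Rd : 'M[R]_md)
    (Bd_full_col_rank : \rank Bd = md)
    (Qd_sym : Qd^T = Qd) (Rd_sym : Rd^T = Rd) (Qd_neg : negdef Qd)
    (Atr : 'M[R]_n) (Btr : 'M[R]_(n, m)) (Dhat : 'M[R]_(md, N))
    (Dhat_noise : noise_set Qd Sd Rd Dhat)
    (data : dX = Atr *m X + Btr *m U + Bd *m Dhat)
    (Pc_inv : Pc dX X U Bd Qd Sd Rd \in unitmx)
    (Pc_inertia : num_pos_eigenvalues (Pc dX X U Bd Qd Sd Rd) md)
    (K : 'M[R]_(m, n)) (h : R) (h_gt0 : 0 < h)
    (lmi : exists (lambda1 lambda2 : R) (P1 R0 P2 P3 : 'M[R]_n),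
       [/\ 0 < lambda1, 0 < lambda2, posdef P1, posdef R0 &
         let Pt := tilde_mx (Pc dX X U Bd Qd Sd Rd) in
         negdef ((F1 K h)^T *m Wmx (PR2mx P1 P2 P3 R0) lambda1 Pt *m F1 K h)
         /\
         negdef ((F2 K h)^T *m Wmx (PRmx P1 P2 P3 R0) lambda2 Pt *m F2 K h)]) :
  forall (A : 'M[R]_n) (B : 'M[R]_(n, m)),
    Sigma_c dX X U Bd Qd Sd Rd (A, B) ->
  forall ts : nat -> R, sampling_sequence h ts ->
    sampled_exp_stable A B K ts.
Proof.
move=> A B AB ts ts_samp; case: lmi => l1 [l2 [P1 [R0 [P2 [P3]]]]].
case=> l1_gt0 l2_gt0 P1_pos R0_pos [lmi1 lmi2].
have tilde_ge0 xi := Sigma_c_tilde_ge0 Qd_sym Rd_sym Qd_neg xi Pc_inv AB.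
have [eps eps_gt0 decay] := delay_lmi_decay l1_gt0 l2_gt0 tilde_ge0 lmi1 lmi2.
have [c0 c0_gt0 P1_ge] := posdef_coercive P1_pos.
have [c1 c1_gt0 P1_le] := bform_bounded P1.
have [c2 c2_gt0 R0_le] := bform_bounded R0.
have C_gt0 : 0 < c1 + c2 * h ^+ 2 by rewrite addr_gt0 // mulr_gt0 // exprn_gt0.
(* The largest rate that the decay estimate allows. *)
pose alpha := eps / (c1 + c2 * h ^+ 2).
have alpha_gt0 : 0 < alpha by rewrite divr_gt0.
have alpha_le : alpha * (c1 + c2 * h ^+ 2) <= eps by rewrite divfK // gt_eqF.
(* From c0 |x|^2 <= x^T P1 x <= c1 |x|^2, the squared norm decays at rate alpha with factor c1 / c0;
   the square root halves the rate. *)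
exists (Num.sqrt (c1 / c0)), (alpha / 2); split; [by rewrite sqrtr_gt0 divr_gt0 | by rewrite divr_gt0 |].
move=> x x_traj t t_ge0.
have V_le := sampled_trajectory_decay P1_pos R0_pos decay P1_le R0_le
  (ltW c1_gt0) (ltW c2_gt0) (ltW alpha_gt0) alpha_le ts_samp x_traj t_ge0.
set E := expR (- (alpha / 2) * t).
have EE : expR (- alpha * t) = E ^+ 2.
  by rewrite /E -expRM_natl; congr expR; field.
have sq_le : sqnorm (x t) <= c1 / c0 * (E ^+ 2 * sqnorm (x 0)).
  rewrite mulrAC ler_pdivlMr // mulrC; apply: le_trans (P1_ge _) _.
  apply: le_trans V_le _; rewrite EE mulrCA ler_wpM2l ?sqr_ge0 //; exact: P1_le.
have E_ge0 : 0 <= E := expR_ge0 _.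
rewrite -[E]ger0_norm // -sqrtr_sqr /enorm -/(sqnorm (x t)) -/(sqnorm (x 0)).
rewrite -mulrA -sqrtrM ?sqr_ge0 // -sqrtrM ?(divr_ge0 (ltW c1_gt0) (ltW c0_gt0)) //.
exact: ler_wsqrtr.
Qed.
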